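(* Let $X$ be a Fréchet sequence space such that the set of finite sequences is a dense subset of $X$. Let $B_w$ be a weighted shift from $X$ to $X$. Let $(p_j)_{j\ge1}$ be an increasing sequence of seminorms inducing the topology of $X$. Suppose that for any $j\ge 1$ and any $(x_k)_{k\ge0},(y_k)_{k\ge0}\in X$, $$(|x_k|\le|y_k|\text{ for any }k\ge0)\ \Rightarrow\ p_j((x_k)_{k\ge0})\le p_j((y_k)_{k\ge0}).$$ Then the operator $B_w$ possesses a hypercyclic subspace of type $2$ if and only if for any $j\ge1$, the set $\{k\ge0:p_j(e_k)=0\}$ contains arbitrarily long intervals (of consecutive integers).
   Context: $\mathbb{K}=\mathbb{R}$ or $\mathbb{C}$; $\omega=\mathbb{K}^{\mathbb{Z}_+}$ with the product topology (sequences indexed by non-negative integers), with canonical basis $(e_n)_{n\ge0}$. A Fréchet sequence space is a Fréchet space $X$ that is a subspace of $\omega$ such that the embedding $X\hookrightarrow\omega$ is continuous. Finite sequences are finitely supported sequences. A weighted shift $B_w$ is the map $B_w((x_n)_{n\ge0})=(w_{n+1}x_{n+1})_{n\ge0}$, i.e. $B_we_n=w_ne_{n-1}$ with $e_{-1}=0$, where $(w_n)_{n\ge1}$ is a sequence of non-zero scalars; it is assumed to map $X$ to $X$ (and is then automatically continuous). A vector $x$ is hypercyclic for $B_w$ if its orbit $\{B_w^nx\}_n$ is dense in $X$; a hypercyclic subspace is a closed infinite-dimensional subspace $M$ of $X$ in which every non-zero vector is hypercyclic; it is of type $2$ if for any continuous seminorm $p$ on $X$, $M\cap\ker p$ is infinite-dimensional.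 *)

(* Defs.v *)
From HB Require Import structures.
From mathcomp Require Import all_boot all_order all_algebra.
From mathcomp Require Import all_classical all_reals all_analysis.
From mathcomp Require Import complex.

Set Implicit Arguments.
Unset Strict Implicit.
Unset Printing Implicit Defensive.

Import Order.TTheory GRing.Theory Num.Theory.
Import numFieldNormedType.Exports.

Local Open Scope classical_set_scope.
Local Open Scope ring_scope.

Variant real_or_complex : numFieldType -> Prop :=
| Real_scalars (R : realType) : real_or_complex R
| Complex_scalars (R : realType) : real_or_complex (R[i])%C.

Section FrechetSpaces.
Context {K : numFieldType}.

(* As for the norms of MathComp, the values live in [K]; over the complex
   numbers [0 <= p x] says in particular that [p x] is real. *)
Definition seminorm {X : lmodType K} (p : X -> K) : Prop :=
  [/\ forall x, 0 <= p x,
      forall x y, p (x + y) <= p x + p y &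
      forall (a : K) x, p (a *: x) = `|a| * p x].

Definition seminorms_induce_topology {X : tvsType K} (p : nat -> X -> K) : Prop :=
  forall (x : X) (U : set X), nbhs x U <->
    exists n : nat, exists2 eps : K, 0 < eps &
      forall y, (forall j, (j <= n)%N -> p j (y - x) < eps) -> U y.

(* Cauchy sequences are those of the additive group structure: the axioms of
   [tvsType] do not tie its uniform structure to translations. *)
Definition cauchy_sequence {X : tvsType K} (u : nat -> X) : Prop :=
  forall U : set X, nbhs (0 : X) U ->
    exists N : nat, forall m n, (N <= m)%N -> (N <= n)%N -> U (u m - u n).

Definition frechet_space (X : tvsType K) : Prop :=
  [/\ hausdorff_space X,
      exists2 p : nat -> X -> K,
        forall j, seminorm (p j) & seminorms_induce_topology p &
      forall u : nat -> X, cauchy_sequence u -> exists l : X, u @ \oo --> l].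

(* The inclusion of X in the space of all scalar sequences is represented by
   the injective linear map [coef], [coef x k] being the [k]-th term of [x]. *)
Definition frechet_sequence_space (X : tvsType K)
    (coef : {linear X -> (nat -> K)}) : Prop :=
  [/\ frechet_space X, injective coef &
      continuous (coef : X -> {ptws nat -> K})].

Definition finite_sequences : set (nat -> K) :=
  [set x | exists N : nat, forall k, (N <= k)%N -> x k = 0].

Definition unit_sequence (n : nat) : nat -> K := fun k => (k == n)%:R.

(* [w 0] is irrelevant. *)
Definition weighted_shift {X : tvsType K} (coef : {linear X -> (nat -> K)})
    (w : nat -> K) (B : X -> X) : Prop :=
  (forall n, (1 <= n)%N -> w n != 0) /\
  (forall x n, coef (B x) n = w n.+1 * coef x n.+1).

Definition hypercyclic_vector {X : tvsType K} (T : X -> X) (x : X) : Prop :=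
  dense (range (fun n : nat => iter n T x)).

Definition infinite_dimensional {X : lmodType K} (M : set X) : Prop :=
  ~ exists n, exists2 v : 'I_n -> X, forall i, M (v i) &
      forall x, M x -> exists c : 'I_n -> K, x = \sum_(i < n) c i *: v i.

Definition hypercyclic_subspace {X : tvsType K} (T : X -> X) (M : set X) : Prop :=
  [/\ submod_closed [in M], closed M, infinite_dimensional M &
      forall x, M x -> x != 0 -> hypercyclic_vector T x].

Definition hypercyclic_subspace_type2 {X : tvsType K} (T : X -> X)
    (M : set X) : Prop :=
  hypercyclic_subspace T M /\
  forall p : X -> K, seminorm p -> continuous p ->
    infinite_dimensional (M `&` [set x | p x = 0]).

End FrechetSpaces.

Definition contains_arbitrarily_long_intervals (A : set nat) : Prop :=
  forall L : nat, exists a : nat, forall k, (a <= k < a + L)%N -> A k.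

(* Main.v *)
Require Import Defs.
From HB Require Import structures.
From mathcomp Require Import all_boot all_order all_algebra.
From mathcomp Require Import all_classical all_reals all_analysis.
From mathcomp Require Import complex zify.

Import Order.TTheory GRing.Theory Num.Theory.
Import numFieldNormedType.Exports.

Local Open Scope classical_set_scope.
Local Open Scope ring_scope.

(** Write [Z j] for the set of [k] with [p j (e k) = 0]; these sets decrease
    with [j].  Density of the finite sequences and monotonicity of the
    seminorms make the truncations of a vector converge to it, so that
    [p j x = 0] if and only if [x] is supported in [Z j]
    ([seminorm_support], [seminorm_null_support]).

    If [M] is a hypercyclic subspace of type 2, then [M] contains a non-zero
    vector [x] with [p j x = 0].  Its orbit meets the open set of vectors whose
    first [L] coordinates are all non-zero.  These coordinates of [B^n x] are
    non-zero multiples of the coordinates [n, ..., n + L - 1] of [x], hence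
    [Z j] contains this interval ([long_null_intervals]).

    Conversely, let every [Z j] contain arbitrarily long intervals.  Pick
    disjoint blocks, of length [l] and starting at [a l], such that not only the
    block [l] but also its translates to the left by [a l'] with [l' < l] are
    contained in [Z l]; this only requires to start the block far enough inside
    a long interval of [Z l] ([separated_blocks]).  Every scalar sequence
    supported in the union of the blocks belongs to [X], for the seminorm [p j]
    of its truncations does not see the blocks of index at least [j]
    ([eventually_null_sequence]).  On the block [l] put a preimage under [B^(a l)] of a finite sequence [s l], where every block also carries
    a class [cls l], and where each class approximates each finite sequence
    infinitely often ([recurrent_approximations]).  The subspace [M] consists of
    the vectors obtained by multiplying the entries of each class by a scalar
    depending on the class only.

    - If the scalar [c] of a class is non-zero, then for infinitely many [l] in
      this class [B^(a l) x] starts with [c *: s l], and its coordinates of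
      index at least [l] come from the later blocks, translated by [a l]: they
      lie in [Z l], where the seminorms [p j] with [j <= l] vanish.  The
      multiples by [c] of the sequences [s l] being dense, [x] is hypercyclic
      ([class_multiple_hypercyclic]).
    - [M] is closed, as it is given by equations between pairs of coordinates
      ([class_multiples_closed]).
    - All but finitely many classes have only blocks of index larger than [j];
      their indicators are linearly independent vectors of [M] on which [p j]
      vanishes, and every continuous seminorm vanishes where some [p j] does
      ([kernel_infinite_dimensional], [continuous_seminorm_kernel]). *)

(** * Dense sequences of scalars *)

Lemma ratr_dense (R : realType) (z eps : R) :
  0 < eps -> exists r : rat, `|z - ratr r| < eps.
Proof.
move=> eps0.
have [r] : exists r, ratr r \in `]z - eps, z + eps[.
  by apply: rat_in_itvoo; rewrite ltrBlDr -addrA ltrDl addr_gt0.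
by rewrite in_itv /= -ltr_distl distrC => rz; exists r.
Qed.

Lemma scalars_separable (K : numFieldType) : real_or_complex K ->
  exists q : nat -> K,
    forall z eps : K, 0 < eps -> exists n, `|z - q n| < eps.
Proof.
case=> R.
  exists (fun n => ratr (odflt 0 (unpickle n))) => z eps eps0.
  have [r zr] := @ratr_dense R z eps eps0.
  by exists (pickle r); rewrite pickleK.
exists (fun n => let: (r, s) := odflt (0, 0) (unpickle n) in
  (ratr r +i* ratr s)%C) => -[x y] [eps b].
rewrite ltcE /= => /andP[/eqP-> eps0].
have eps20 : 0 < eps / 2 by rewrite divr_gt0.
have [r xr] := @ratr_dense R x _ eps20.
have [s ys] := @ratr_dense R y _ eps20.
exists (pickle (r, s)); rewrite pickleK /=.
rewrite (_ : (_ +i* _ - _)%C =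
  (x - ratr r)%:C%C + 'i%C * (y - ratr s)%:C%C); last first.
  by apply/eqP; rewrite eq_complex /=; apply/andP; split; apply/eqP; simpc.
apply: le_lt_trans (ler_normD _ _) _.
rewrite normrM !normc_def /= !expr0n !expr1n !addr0 add0r sqrtr1 mul1r !sqrtr_sqr.
by rewrite -rmorphD ltcR (splitr eps) ltrD.
Qed.

Lemma injective_nat_unbounded (f : nat -> nat) (L : nat) :
  injective f -> exists n, (L <= f n)%N.
Proof.
move=> f_inj; apply/not_existsP => small.
have f_uniq : uniq (map f (iota 0 L.+1)) by rewrite map_inj_uniq ?iota_uniq.
suff /(uniq_leq_size f_uniq) : {subset map f (iota 0 L.+1) <= iota 0 L}.
  by rewrite size_map !size_iota ltnn.
by move=> _ /mapP[n _ ->]; rewrite mem_iota /= ltnNge; apply/negP/small.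
Qed.

(** The index [l] encodes a triple made of the class, a list of indices in the
    dense sequence, and a counter.  The counter serves only to make each pair of
    the first two occur for arbitrarily large [l]. *)
Lemma recurrent_approximations (K : numFieldType) : real_or_complex K ->
  exists (cls : nat -> nat) (s : nat -> seq K),
    forall (i L N : nat) (y : nat -> K) (delta : K), 0 < delta ->
      exists l, [/\ (L <= l)%N, cls l = i, (size (s l) <= N)%N &
        forall k, (k < N)%N -> `|y k - (s l)`_k| < delta].
Proof.
move=> /scalars_separable[q q_dense].
pose code (l : nat) : nat * seq nat * nat := odflt (0%N, [::], 0%N) (unpickle l).
exists (fun l => (code l).1.1), (fun l => map q (code l).1.2).
move=> i L N y delta delta0.
have [t yt] : exists t, forall k, `|y k - q (t k)| < delta.
  exists (fun k => sval (cid (q_dense (y k) delta delta0))) => k.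
  by case: cid.
have [|n Ln] := @injective_nat_unbounded (fun n => pickle (i, mkseq t N, n)) L.
  by move=> m n /(pcan_inj pickleK)[].
exists (pickle (i, mkseq t N, n)); rewrite /code pickleK /=.
split=> // [|k kN]; first by rewrite size_map size_mkseq.
by rewrite (nth_map 0%N) ?size_mkseq// nth_mkseq.
Qed.

(** * Seminorms and infinite-dimensional sets *)

Section Seminorms.
Context {K : numFieldType} {X : lmodType K} {p : X -> K} (sp : seminorm p).

Lemma seminorm0 : p 0 = 0.
Proof. by case: sp => _ _ pZ; rewrite -(scale0r 0) pZ normr0 mul0r. Qed.

Lemma seminormN x : p (- x) = p x.
Proof. by case: sp => _ _ pZ; rewrite -scaleN1r pZ normrN1 mul1r. Qed.

Lemma seminormB x y : p (x - y) = p (y - x).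
Proof. by rewrite -seminormN opprB. Qed.

Lemma seminorm_dist x y : `|p x - p y| <= p (x - y).
Proof.
have [p0 pD _] := sp.
have le_pB u v : p u - p v <= p (u - v).
  by rewrite lerBlDr (le_trans _ (pD _ _)) ?subrK.
have rp u : p u \is Num.real by apply: ger0_real.
by rewrite real_ler_norml ?rpredB// lerNl opprB le_pB seminormB le_pB.
Qed.

Lemma seminorm_eq0 x : (forall eps, 0 < eps -> p x < eps) -> p x = 0.
Proof.
move=> small; apply/eqP/negPn/negP => px_neq0.
have /small : 0 < p x by rewrite lt_def px_neq0; case: sp => ->.
by rewrite ltxx.
Qed.

Lemma seminorm_sum (I : Type) (r : seq I) (F : I -> X) :
  p (\sum_(i <- r) F i) <= \sum_(i <- r) p (F i).
Proof.
elim/big_rec2: _ => [|i y x _ le_xy]; first by rewrite seminorm0.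
by have [_ pD _] := sp; rewrite (le_trans (pD _ _)) ?lerD2l.
Qed.

End Seminorms.

(** The coefficient matrix of [n + 1] of the vectors on a spanning family of
    length [n] has more rows than columns, so that its rows are dependent. *)
Lemma infinite_dimensional_free {K : numFieldType} {X : lmodType K}
    (M : set X) (u : nat -> X) :
  (forall i, M (u i)) ->
  (forall n (d : 'I_n -> K),
     \sum_(i < n) d i *: u i = 0 -> forall i, d i = 0) ->
  infinite_dimensional M.
Proof.
move=> Mu u_free [n [v _ v_span]].
have /choice[C uC] : forall i, exists c : 'I_n -> K,
    u i = \sum_(j < n) c j *: v j by move=> i; apply: v_span.
pose A : 'M[K]_(n.+1, n) := \matrix_(i, j) C i j.
have /rowV0Pn[d /sub_kermxP dA d_neq0] : kermx A != 0.
  by rewrite kermx_eq0 -row_leq_rank -ltnNge ltnS rank_leq_col.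
case/eqP: d_neq0; apply/rowP => i; rewrite mxE.
apply: (u_free n.+1 (fun i => d 0 i)).
under eq_bigr => k _ do rewrite uC scaler_sumr.
rewrite exchange_big big1//= => j _.
under eq_bigr => k _ do rewrite scalerA.
have dAj : \sum_k d 0 k * C k j = (d *m A) 0 j.
  by rewrite mxE; apply: eq_bigr => k _; rewrite mxE.
by rewrite -scaler_suml dAj dA mxE scale0r.
Qed.

(** * Topologies given by increasing seminorms *)

Section SeminormTopology.
Context {K : numFieldType} {X : tvsType K} {p : nat -> X -> K}.
Context (hp : forall j, seminorm (p j))
  (hp_incr : forall i j x, (i <= j)%N -> p i x <= p j x)
  (hp_top : seminorms_induce_topology p).

Lemma seminorm_ball_nbhs j (x : X) (eps : K) :
  0 < eps -> nbhs x [set y | p j (y - x) < eps].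
Proof. by move=> eps0; apply/hp_top; exists j, eps => // y; apply. Qed.

(** Since the seminorms increase, one of them suffices where the definition of
    the topology allows finitely many. *)
Lemma nbhs_seminorm_ball (x : X) (U : set X) : nbhs x U ->
  exists j, exists2 eps : K, 0 < eps & forall y, p j (y - x) < eps -> U y.
Proof.
move=> /hp_top[j [eps eps0 U_ball]]; exists j, eps => // y yx.
by apply: U_ball => i ij; apply: le_lt_trans yx; apply: hp_incr.
Qed.

Lemma defining_seminorm_continuous j : continuous (p j).
Proof.
move=> x; apply/cvgrPdist_lt => eps eps0.
apply: filterS; last exact: (@seminorm_ball_nbhs j x eps eps0).
move=> y /= yx.
by rewrite (le_lt_trans (seminorm_dist (hp j) _ _))// (seminormB (hp j)).
Qed.

(** Continuity at 0 bounds [r] by 1 on a ball of some [p j].  If [p j x = 0],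
    this ball contains all multiples of [x]. *)
Lemma continuous_seminorm_kernel (r : X -> K) :
  seminorm r -> continuous r ->
  exists j, forall x, p j x = 0 -> r x = 0.
Proof.
move=> sr cr; have [r0 _ rZ] := sr.
have : nbhs (0 : X) [set x | r x < 1].
  have /cvgrPdist_lt /(_ 1 ltr01) := cr 0.
  apply: filterS => x /=; rewrite (seminorm0 sr) sub0r normrN.
  by rewrite ger0_norm.
move=> /nbhs_seminorm_ball[j [eps eps0 ball_r]]; exists j => x pjx0.
apply: (seminorm_eq0 sr) => t t0.
have : r (t^-1 *: x) < 1.
  apply: ball_r; have [_ _ pZ] := hp j.
  by rewrite subr0 pZ pjx0 mulr0.
by rewrite rZ gtr0_norm ?invr_gt0// mulrC ltr_pdivrMr// mul1r.
Qed.

End SeminormTopology.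

(** * Sequence spaces with monotone seminorms *)

Section SolidSequenceSpace.
Context {K : numFieldType} {X : tvsType K} {coef : {linear X -> (nat -> K)}}
  (hX : frechet_sequence_space coef)
  (hdense : dense (coef @^-1` finite_sequences))
  {e : nat -> X} (he : forall n, coef (e n) = unit_sequence n)
  {p : nat -> X -> K}
  (hp : forall j, seminorm (p j))
  (hp_incr : forall i j x, (i <= j)%N -> p i x <= p j x)
  (hp_top : seminorms_induce_topology p)
  (hp_mono : forall j x y,
    (forall k, `|coef x k| <= `|coef y k|) -> p j x <= p j y).

Lemma coef_inj : injective coef.
Proof. by case: hX. Qed.

Lemma coordinate_continuous k : continuous (fun x : X => coef x k).
Proof.
move=> x; have [_ _ coef_cont] := hX.
exact: (continuous_comp (coef_cont x) (@proj_continuous nat (fun=> K) k _)).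
Qed.

Lemma seq_coefD x y k : coef (x + y) k = coef x k + coef y k.
Proof. by rewrite linearD. Qed.

Lemma seq_coefB x y k : coef (x - y) k = coef x k - coef y k.
Proof. by rewrite linearB. Qed.

Lemma seq_coefZ a x k : coef (a *: x) k = a * coef x k.
Proof. by rewrite linearZ. Qed.

Lemma seq_coef0 k : coef 0 k = 0.
Proof. by rewrite linear0. Qed.

Lemma seq_coef_sum n (F : 'I_n -> X) k :
  coef (\sum_(i < n) F i) k = \sum_(i < n) coef (F i) k.
Proof.
elim/big_rec2: _ => [|i y x _ <-]; first exact: seq_coef0.
by rewrite seq_coefD.
Qed.

Lemma coef_finite_sum N (c : nat -> K) k :
  coef (\sum_(i < N) c i *: e i) k = if (k < N)%N then c k else 0.
Proof.
rewrite seq_coef_sum; under eq_bigr => i _ do rewrite seq_coefZ he /unit_sequence.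
case: ifPn => [kN|Nk].
  rewrite (bigD1 (Ordinal kN)) //= eqxx mulr1 big1 ?addr0// => i.
  by rewrite -val_eqE /= eq_sym => /negPf->; rewrite mulr0.
by rewrite big1 // => i _; case: eqP Nk => [->|]; rewrite ?ltn_ord ?mulr0.
Qed.

(** By monotonicity, [p j x] dominates the seminorm of each term
    [coef x k *: e k]. *)
Lemma seminorm_support j x k : p j x = 0 -> coef x k != 0 -> p j (e k) = 0.
Proof.
move=> pjx0 xk_neq0; have [p0 _ pZ] := hp j; apply/eqP.
have : p j (coef x k *: e k) <= p j x.
  apply: hp_mono => i; rewrite seq_coefZ he /unit_sequence.
  by case: eqP => [->|_]; rewrite ?mulr1 ?mulr0 ?normr0.
by rewrite pjx0 pZ pmulr_rle0 ?normr_gt0// => pek; rewrite eq_le pek p0.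
Qed.

(** All truncations of [x] have seminorm 0.  They approximate [x] because, if [y]
    is a finite sequence close to [x], supported below [m], then the tail of [x]
    from [m] on is dominated termwise by [y - x]. *)
Lemma seminorm_null_support j x :
  (forall k, coef x k != 0 -> p j (e k) = 0) -> p j x = 0.
Proof.
move=> null; have [p0 pD pZ] := hp j.
apply: (seminorm_eq0 (hp j)) => eps eps0.
have /hdense : [set y | p j (y - x) < eps]^° !=set0.
  by exists x; apply: (seminorm_ball_nbhs hp_top).
move=> /(_ (open_interior _))[y [/interior_subset /= yx [m y_fin]]].
rewrite -(subrK (\sum_(k < m) coef x k *: e k) x) (le_lt_trans (pD _ _))//.
rewrite [X in _ + X](_ : _ = 0) ?addr0.
  apply: le_lt_trans yx; apply: hp_mono => k; rewrite !seq_coefB coef_finite_sum.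
  case: ltnP => km; first by rewrite subrr normr0.
  by rewrite (y_fin k km) sub0r subr0 normrN.
apply/eqP; rewrite eq_le p0 andbT (le_trans (seminorm_sum (hp j) _ _ _))//.
rewrite big1 // => k _; rewrite pZ.
have [->|/null->] := eqVneq (coef x k) 0; first by rewrite normr0 mul0r.
by rewrite mulr0.
Qed.

Lemma seminorm_le_head j N x :
  (forall k, (N <= k)%N -> coef x k != 0 -> p j (e k) = 0) ->
  p j x <= \sum_(k < N) `|coef x k| * p j (e k).
Proof.
move=> null_tail; have [p0 pD pZ] := hp j.
rewrite -[in leLHS](subrK (\sum_(k < N) coef x k *: e k) x).
rewrite (le_trans (pD _ _))// seminorm_null_support ?add0r => [|k].
  rewrite (le_trans (seminorm_sum (hp j) _ _ _))//.
  by apply: ler_sum => k _; rewrite pZ.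
rewrite seq_coefB coef_finite_sum; case: ltnP => Nk; first by rewrite subrr eqxx.
by rewrite subr0; apply: null_tail.
Qed.

(** For each [j], the truncations are eventually constant with respect to [p j],
    whatever the size of the terms; hence they form a Cauchy sequence, and its
    limit has the right coordinates. *)
Lemma eventually_null_sequence (x : nat -> K) :
  (forall j, exists N, forall k, (N <= k)%N -> x k != 0 -> p j (e k) = 0) ->
  exists z, coef z = x.
Proof.
move=> null; pose s n := \sum_(k < n) x k *: e k.
have s_cauchy : cauchy_sequence s.
  move=> U /(nbhs_seminorm_ball hp_incr hp_top)[j [eps eps0 ballU]].
  have [N nullN] := null j; exists N => m n Nm Nn; apply: ballU.
  rewrite subr0 seminorm_null_support // => k.
  rewrite seq_coefB !coef_finite_sum => xk_neq0.
  have [kN|Nk] := ltnP k N.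
    by move: xk_neq0; rewrite !(leq_trans kN) // subrr eqxx.
  apply: nullN Nk _; apply: contra_neq xk_neq0 => ->.
  by rewrite !if_same subrr.
have [[_ _ complete] _ _] := hX; have [z sz] := complete s s_cauchy.
exists z; apply/funext => k.
have sk : (fun n => coef (s n) k) @ \oo --> coef z k.
  exact: (continuous_cvg _ (@coordinate_continuous k z) sz).
apply: (@norm_cvg_unique K K^o _ _ _ _ sk); apply: cvg_near_cst.
by exists k.+1 => // n /= kn; rewrite coef_finite_sum kn.
Qed.

End SolidSequenceSpace.

(** * Subspaces of vectors proportional to a fixed sequence on each class *)

Definition class_multiples {K : numFieldType} {X : tvsType K}
    (coef : {linear X -> (nat -> K)}) (cls : nat -> nat) (g : nat -> K) : set X :=
  [set x | exists c : nat -> K, forall k, coef x k = c (cls k) * g k].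

Section ClassMultiples.
Context {K : numFieldType} {X : tvsType K} {coef : {linear X -> (nat -> K)}}
  (hX : frechet_sequence_space coef) (cls : nat -> nat) (g : nat -> K).

Lemma class_multiples_submod : submod_closed [in class_multiples coef cls g].
Proof.
split=> [|a x y]; rewrite !inE.
  by exists (fun=> 0) => k; rewrite seq_coef0 mul0r.
move=> [c xc] [d yd]; exists (fun i => a * c i + d i) => k.
by rewrite seq_coefD seq_coefZ xc yd mulrDl mulrA.
Qed.

(** This eliminates the unknown scalars [c], so that what remains are equations
    between continuous functions of [x]. *)
Lemma class_multiples_cross : class_multiples coef cls g =
  [set x | forall k, g k = 0 -> coef x k = 0] `&`
  [set x | forall k k', cls k = cls k' -> coef x k * g k' = coef x k' * g k].
Proof.
apply/seteqP; split=> [x [c xc]|x [/= x0 x_cross]].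
  split=> [k gk|k k' kk'] /=; first by rewrite xc gk mulr0.
  by rewrite !xc kk' mulrAC.
pose rep i := xget 0%N [set k | cls k = i /\ g k != 0].
exists (fun i => coef x (rep i) / g (rep i)) => k.
have [gk0|gk_neq0] := eqVneq (g k) 0; first by rewrite gk0 mulr0 x0.
have [rep_cls g_rep] : [set k' | cls k' = cls k /\ g k' != 0] (rep (cls k)).
  by apply: xgetPex; exists k.
by rewrite mulrAC -x_cross ?mulfK.
Qed.

Lemma coordinate_equation_closed (a b : K) k k' :
  closed [set x : X | coef x k * a = coef x k' * b].
Proof.
pose f x := coef x k * a - coef x k' * b.
rewrite (_ : [set _ | _] = f @^-1` [set 0]); last first.
  apply/seteqP; split=> x /=; rewrite /f; first by move=> ->; rewrite subrr.
  exact: subr0_eq.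
apply: preimage_closed; last first.
  apply: accessible_closed_set1; apply: hausdorff_accessible.
  exact: (@norm_hausdorff K K^o).
have cont_term i c : continuous (fun x : X => coef x i * c).
  move=> x; apply: (@continuousM K X _ (fun=> c)); last exact: cst_continuous.
  exact: (coordinate_continuous hX).
by move=> x _; apply: (@cvgB K K^o); apply: cont_term.
Qed.

Lemma class_multiples_closed : closed (class_multiples coef cls g).
Proof.
rewrite class_multiples_cross; apply: closedI.
  rewrite (_ : [set _ | _] =
      \bigcap_(k in [set k | g k = 0]) [set x | coef x k * 1 = coef x k * 0]).
    by apply: closed_bigI => k _; apply: coordinate_equation_closed.
  by apply/seteqP; split=> x /= x0 k gk;
    have /= := x0 k gk; rewrite mulr1 mulr0.
rewrite (_ : [set _ | _] =
    \bigcap_(kk in [set kk : nat * nat | cls kk.1 = cls kk.2])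
      [set x | coef x kk.1 * g kk.2 = coef x kk.2 * g kk.1]).
  by apply: closed_bigI => k _; apply: coordinate_equation_closed.
by apply/seteqP; split=> x /= xE => [[k k']|k k' kk'] /=;
  [apply: xE|apply: (xE (k, k'))].
Qed.

Lemma class_indicators_infinite_dimensional (b : nat) (u : nat -> X) (M : set X) :
  (forall i, exists2 k, cls k = i & g k != 0) ->
  (forall i k, coef (u i) k = (cls k == (b + i)%N)%:R * g k) ->
  (forall i, M (u i)) -> infinite_dimensional M.
Proof.
move=> cls_inhab uE Mu; apply: infinite_dimensional_free Mu _ => n d du0 i.
have [k ki gk_neq0] := cls_inhab (b + i)%N.
have := seq_coef_sum (coef := coef) n (fun i : 'I_n => d i *: u i) k.
rewrite du0 seq_coef0 (bigD1 i) //= big1 => [|i' i'i].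
  rewrite addr0 seq_coefZ uE ki eqxx mul1r => /esym/eqP.
  by rewrite mulf_eq0 (negPf gk_neq0) orbF => /eqP.
by rewrite seq_coefZ uE ki eqn_add2l eq_sym val_eqE (negPf i'i) mul0r mulr0.
Qed.

End ClassMultiples.

(** The second property covers both the translate of the block [l] to the left by
    [a l'], which is what the orbit sees, and the block [l] itself, because
    [a l <= k] implies [a l <= k + a l'].  To satisfy it for [l.+1], the block
    starts [a l + l] steps inside an interval contained in [Z l.+1]. *)
Lemma separated_blocks (Z : nat -> set nat) :
  (forall j, contains_arbitrarily_long_intervals (Z j)) ->
  exists a : nat -> nat,
    (forall l l', (l' < l)%N -> (a l' + l' <= a l)%N) /\
    (forall l l' k, (l' < l)%N ->
       (a l <= k + a l')%N -> (k < a l + l)%N -> Z l k).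
Proof.
move=> Z_long.
have /choice[next nextP] : forall lm : nat * nat, exists b, (lm.2 <= b)%N /\
    forall k, (b <= k + lm.2)%N -> (k < b + lm.1)%N -> Z lm.1 k.
  move=> [l m]; have [b0 Zb] := Z_long l (m + l)%N.
  by exists (b0 + m)%N => /=; split=> [|k k1 k2]; [lia|apply: Zb; lia].
pose a := fix a l := if l is l'.+1 then next (l, a l' + l')%N else 0%N.
have a_next l : (a l + l <= a l.+1)%N by have [] := nextP (l.+1, a l + l)%N.
have a_sep l l' : (l' < l)%N -> (a l' + l' <= a l)%N.
  elim: l => // l IHl; rewrite ltnS leq_eqVlt => /orP[/eqP->//|/IHl].
  by have := a_next l; lia.
exists a; split=> // -[//|l] l' k l'l ak ka.
have [_] := nextP (l.+1, a l + l)%N; apply=> //=.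
move: l'l; rewrite ltnS leq_eqVlt => /orP[/eqP l'l|/a_sep].
  by move: ak; rewrite l'l /=; lia.
by move: ak => /=; lia.
Qed.

Lemma coef_iter_shift {K : numFieldType} {X : tvsType K}
    {coef : {linear X -> (nat -> K)}} (w : nat -> K) (B : X -> X) n x k :
  weighted_shift coef w B ->
  coef (iter n B x) k = (\prod_(i < n) w (k + i).+1) * coef x (k + n)%N.
Proof.
move=> [_ BE]; elim: n k => [|n IHn] k; first by rewrite big_ord0 mul1r addn0.
rewrite iterS BE IHn big_ord_recl addn0 mulrA addSnnS.
by congr (_ * _ * _); apply: eq_bigr => i _; rewrite /= addSnnS.
Qed.

(** * The coordinates as a union of disjoint blocks *)

(** The block [l] is the interval from [a l] to [a l + l - 1].  The block 0 is
    empty, so that the default value 0 stands for the coordinates outside all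
    blocks. *)
Definition block (a : nat -> nat) (k : nat) : nat :=
  xget 0%N [set l | (a l <= k < a l + l)%N].

Section Blocks.
Context {a : nat -> nat}
  (a_sep : forall l l', (l' < l)%N -> (a l' + l' <= a l)%N).

Lemma block_unique l l' k :
  (a l <= k < a l + l)%N -> (a l' <= k < a l' + l')%N -> l = l'.
Proof.
move=> kl kl'.
by have [/a_sep ?|/a_sep ?|//] := ltngtP l l'; lia.
Qed.

Lemma blockE l k : (a l <= k < a l + l)%N -> block a k = l.
Proof.
move=> kl; apply: (@block_unique _ _ k) => //.
by have := xgetPex 0%N (ex_intro [set l | (a l <= k < a l + l)%N] l kl).
Qed.

Lemma block_bounds k : block a k != 0%N ->
  (a (block a k) <= k < a (block a k) + block a k)%N.
Proof. by rewrite /block; case: xgetP => [l -> //|_]; rewrite eqxx. Qed.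

Lemma lt_block l k : (a l + l <= k)%N -> block a k != 0%N -> (l < block a k)%N.
Proof.
move=> lk /block_bounds kb; rewrite ltnNge leq_eqVlt; apply/negP.
by move=> /orP[/eqP bl|/a_sep ?]; [rewrite bl in kb; lia|lia].
Qed.

End Blocks.

(** * The hypercyclic subspace *)

Section Construction.
Context {K : numFieldType} {X : tvsType K} {coef : {linear X -> (nat -> K)}}
  (hX : frechet_sequence_space coef)
  (hdense : dense (coef @^-1` finite_sequences))
  {e : nat -> X} (he : forall n, coef (e n) = unit_sequence n)
  {w : nat -> K} {B : X -> X} (hB : weighted_shift coef w B)
  {p : nat -> X -> K}
  (hp : forall j, seminorm (p j))
  (hp_incr : forall i j x, (i <= j)%N -> p i x <= p j x)
  (hp_top : seminorms_induce_topology p)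
  (hp_mono : forall j x y,
    (forall k, `|coef x k| <= `|coef y k|) -> p j x <= p j y).

Context {a : nat -> nat}
  (a_sep : forall l l', (l' < l)%N -> (a l' + l' <= a l)%N)
  (a_null : forall l l' k, (l' < l)%N ->
     (a l <= k + a l')%N -> (k < a l + l)%N -> p l (e k) = 0)
  {cls : nat -> nat} {s : nat -> seq K}
  (s_approx : forall (i L N : nat) (y : nat -> K) (delta : K), 0 < delta ->
      exists l, [/\ (L <= l)%N, cls l = i, (size (s l) <= N)%N &
        forall k, (k < N)%N -> `|y k - (s l)`_k| < delta]).

(** The factor by which the [a l]-th iterate of the shift multiplies the
    coordinate that it moves to the position [k]. *)
Definition shift_weight (l k : nat) : K := \prod_(i < a l) w (k + i).+1.

(** Dividing by the weights makes the [a l]-th iterate of the shift move the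
    list [s l], unchanged, to the first [l] coordinates. *)
Definition block_entries (k : nat) : K :=
  let l := block a k in
  if l == 0%N then 0 else (s l)`_(k - a l) / shift_weight l (k - a l).

Definition coordinate_class (k : nat) : nat := cls (block a k).

Lemma shift_weight_neq0 l k : shift_weight l k != 0.
Proof. by have [w_neq0 _] := hB; apply/prodf_neq0 => i _; apply: w_neq0. Qed.

Lemma block_entriesE l k : (k < l)%N ->
  block_entries (k + a l) = (s l)`_k / shift_weight l k.
Proof.
move=> kl; rewrite /block_entries (@blockE _ a_sep l) ?addnK; last by lia.
by have -> : (l == 0)%N = false by lia.
Qed.

Lemma coordinate_classE l k : (k < l)%N -> coordinate_class (k + a l) = cls l.
Proof. by move=> kl; rewrite /coordinate_class (@blockE _ a_sep l)//; lia. Qed.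

Lemma block_entries_neq0 k : block_entries k != 0 -> block a k != 0%N.
Proof. by apply: contra_neq => bk; rewrite /block_entries bk eqxx. Qed.

(** The coordinate [k + a l] lies in a block later than [l], and the translate by
    [a l] of that block is null. *)
Lemma later_block_null j l k : (j <= l)%N -> (l <= k)%N ->
  block_entries (k + a l) != 0 -> p j (e k) = 0.
Proof.
move=> jl lk /block_entries_neq0 bk.
have lb : (l < block a (k + a l))%N.
  by apply: (lt_block a_sep) bk; rewrite addnC leq_add2r.
move: (block_bounds _ bk) lb; set b := block _ _ => kb lb.
have pb0 : p b (e k) = 0 by apply: (a_null b l) => //; lia.
apply/eqP; rewrite eq_le; have [-> _ _] := hp j; rewrite andbT -pb0.
by apply: hp_incr; lia.
Qed.

Lemma high_block_null j k : (j < block a k)%N -> p j (e k) = 0.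
Proof.
move=> jb; have bk : block a k != 0%N by lia.
have /andP[bk1 bk2] := block_bounds _ bk.
apply/eqP; rewrite eq_le; have [-> _ _] := hp j; rewrite andbT.
rewrite -(a_null (block a k) j k) //; first by apply: hp_incr; lia.
by rewrite (leq_trans bk1) ?leq_addr.
Qed.

(** Approximating the sequence with first term 1 within distance 1 gives a list
    with a non-zero first term. *)
Lemma coordinate_class_inhabited i :
  exists2 k, coordinate_class k = i & block_entries k != 0.
Proof.
have [l [l_gt0 li _ s1]] := s_approx i 1 1 (fun=> 1) 1 ltr01.
exists (0 + a l)%N; first by rewrite coordinate_classE.
rewrite block_entriesE // mulf_neq0 ?invr_eq0 ?shift_weight_neq0//.
apply: contraTneq (s1 0%N isT) => ->.
by rewrite subr0 normr1 ltxx.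
Qed.

Lemma class_multiple_exists (c : nat -> K) :
  exists x, forall k, coef x k = c (coordinate_class k) * block_entries k.
Proof.
have [|x xE] := eventually_null_sequence hX hdense he hp hp_incr hp_top hp_mono
    (fun k => c (coordinate_class k) * block_entries k).
  move=> j; exists (a j + j)%N => k jk.
  rewrite mulf_eq0 negb_or => /andP[_ /block_entries_neq0 bk].
  by apply: high_block_null; apply: (lt_block a_sep) bk.
by exists x => k; rewrite xE.
Qed.

(** The classes from [b] on do not meet the blocks of index at most [j], hence the
    indicators of these classes lie in the kernel of [p j]. *)
Lemma kernel_infinite_dimensional j (N : set X) :
  class_multiples coef coordinate_class block_entries `&`
    [set x | p j x = 0] `<=` N ->
  infinite_dimensional N.
Proof.
move=> subN; pose b := (\max_(l < j.+1) cls l).+1.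
have /choice[u uE] : forall i, exists x, forall k, coef x k =
    (coordinate_class k == (b + i)%N)%:R * block_entries k.
  by move=> i; apply: (class_multiple_exists (fun m => (m == (b + i)%N)%:R)).
apply: (class_indicators_infinite_dimensional
  coordinate_class block_entries b u) => //.
  exact: coordinate_class_inhabited.
move=> i; apply: subN; split.
  by exists (fun m => (m == (b + i)%N)%:R).
apply: (seminorm_null_support hdense he hp hp_top hp_mono) => k.
rewrite uE; have [kbi|_] := eqVneq (coordinate_class k); last first.
  by rewrite mul0r eqxx.
move=> _; apply: high_block_null; rewrite ltnNge; apply/negP => kj.
have : (cls (block a k) <= \max_(l < j.+1) cls l)%N.
  exact: (leq_bigmax (F := fun l : 'I_j.+1 => cls l)
    (Ordinal (kj : (_ < j.+1)%N))).
by rewrite -/(coordinate_class k) kbi /b leqNgt ltnS leq_addr.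
Qed.

(** Let [y] be a finite sequence supported below [m], and [c i] a non-zero scalar
    of [x].  For a block [l] of class [i] such that [s l] is close to
    [(c i)^-1 *: y], the difference between the [a l]-th iterate of [x] and [y] is
    small below [m], is 0 from [m] to [l - 1] as [s l] has size at most [m], and
    is null for [p j] from [l] on. *)
Lemma class_multiple_hypercyclic x :
  class_multiples coef coordinate_class block_entries x -> x != 0 ->
  hypercyclic_vector B x.
Proof.
move=> [c xE] x_neq0.
have [k0 xk0] : exists k, coef x k != 0.
  apply/not_existsP => x0; case/eqP: x_neq0; apply: (coef_inj hX).
  by apply/funext => k; rewrite seq_coef0; apply/eqP/negPn/negP/x0.
set i := coordinate_class k0.
have ci_neq0 : c i != 0 by apply: contraNneq xk0 => ci0; rewrite xE ci0 mul0r.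
move=> O O_neq0 O_open.
have [y [Oy [m y_fin]]] := hdense _ O_neq0 O_open.
have [j [eps eps0 ballO]] :=
  nbhs_seminorm_ball hp_incr hp_top _ _ (open_nbhs_nbhs (conj O_open Oy)).
pose S := \sum_(k < m) p j (e k).
have S1_gt0 : 0 < 1 + S.
  by rewrite ltr_pwDl// sumr_ge0// => k _; have [-> _ _] := hp j.
(* Adding 1 to [S] keeps the denominator non-zero when all [p j (e k)] are 0. *)
pose delta := eps / (`|c i| * (1 + S)).
have delta0 : 0 < delta by rewrite divr_gt0// mulr_gt0// normr_gt0.
have [l [jml li s_size sE]] :=
  s_approx i (maxn j m) m (fun k => coef y k / c i) delta delta0.
exists (iter (a l) B x); split; last by exists (a l).
apply: ballO.
have DE k : coef (iter (a l) B x - y) k =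
    shift_weight l k * coef x (k + a l) - coef y k.
  by rewrite seq_coefB (coef_iter_shift _ _ _ _ _ hB).
have D_block k : (k < l)%N ->
    coef (iter (a l) B x - y) k = c i * (s l)`_k - coef y k.
  move=> kl; rewrite DE xE coordinate_classE // li block_entriesE//.
  by rewrite mulrCA [shift_weight _ _ * _]mulrC divfK ?shift_weight_neq0.
apply: le_lt_trans
    (seminorm_le_head hdense he hp hp_top hp_mono j m _ _) _ => [k mk|].
  have [kl|lk] := ltnP k l.
    rewrite D_block // nth_default ?(leq_trans s_size)// y_fin//.
    by rewrite mulr0 subrr eqxx.
  rewrite DE y_fin // subr0 xE !mulf_eq0 !negb_or => /and3P[_ _].
  by apply: later_block_null => //; lia.
apply: (@le_lt_trans _ _ (\sum_(k < m) `|c i| * delta * p j (e k))).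
  apply: ler_sum => k _; have [pj0 _ _] := hp j.
  have km : (k < m)%N by [].
  rewrite ler_wpM2r// D_block; last by lia.
  rewrite (_ : _ - _ = - (c i * (coef y k / c i - (s l)`_k))).
    by rewrite normrN normrM ler_wpM2l// ltW// sE.
  by rewrite mulrBr mulrCA divff// mulr1 opprB.
rewrite -mulr_sumr -/S /delta invfM [_ * (eps * _)]mulrCA.
rewrite mulVKf ?normr_eq0//.
by rewrite -mulrA gtr_pMr// ltr_pdivrMl// mulr1 ltrDr.
Qed.

Lemma class_multiples_hypercyclic_subspace_type2 :
  hypercyclic_subspace_type2 B
    (class_multiples coef coordinate_class block_entries).
Proof.
split.
  split; first exact: class_multiples_submod.
  - exact: class_multiples_closed.
  - by apply: (@kernel_infinite_dimensional 0) => x [].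
  - exact: class_multiple_hypercyclic.
move=> r sr cr.
have [j jr] := continuous_seminorm_kernel hp hp_incr hp_top r sr cr.
apply: (@kernel_infinite_dimensional j) => x [Mx pjx]; split=> //.
exact: jr.
Qed.

End Construction.

(** * The characterization *)

(** Some iterate of [x] has its first [L] coordinates different from 0, as this
    holds in a non-empty open set. *)
Lemma long_null_intervals {K : numFieldType} {X : tvsType K}
    {coef : {linear X -> (nat -> K)}} (hX : frechet_sequence_space coef)
    (hfin : finite_sequences `<=` range coef)
    {w : nat -> K} {B : X -> X} (hB : weighted_shift coef w B)
    (x : X) (A : set nat) :
  hypercyclic_vector B x -> (forall k, coef x k != 0 -> A k) ->
  contains_arbitrarily_long_intervals A.
Proof.
move=> hx xA L.
pose U := [set y : X | forall k : 'I_L, coef y k != 0].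
have U_neq0 : U^° !=set0.
  have [|z _ zE] := hfin (fun k => (k < L)%N%:R).
    by exists L => k; rewrite leqNgt => /negPf->.
  exists z; apply: filter_forall => k.
  apply: (@cvgr_neq0 K K^o _ _ _ _ _ (coordinate_continuous hX k z)).
  by rewrite zE ltn_ord oner_eq0.
have [y [/interior_subset Uy [n _ yE]]] := hx _ U_neq0 (open_interior U).
exists n => k /andP[nk kL]; apply: xA.
have kn : (k - n < L)%N by lia.
have := Uy (Ordinal kn); rewrite /= -yE (coef_iter_shift _ _ _ _ _ hB) subnK//.
by rewrite mulf_eq0 negb_or => /andP[].
Qed.

Theorem theorem4p18 (K : numFieldType) (hK : real_or_complex K)
  (X : tvsType K) (coef : {linear X -> (nat -> K)})
  (hX : frechet_sequence_space coef)
  (hfin : finite_sequences `<=` range coef)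
  (hdense : dense (coef @^-1` finite_sequences))
  (e : nat -> X) (he : forall n, coef (e n) = unit_sequence n)
  (w : nat -> K) (B : X -> X) (hB : weighted_shift coef w B)
  (p : nat -> X -> K)
  (hp : forall j, seminorm (p j))
  (hp_incr : forall i j x, (i <= j)%N -> p i x <= p j x)
  (hp_top : seminorms_induce_topology p)
  (hp_mono : forall j x y,
    (forall k, `|coef x k| <= `|coef y k|) -> p j x <= p j y) :
  (exists M : set X, hypercyclic_subspace_type2 B M) <->
  (forall j, contains_arbitrarily_long_intervals [set k | p j (e k) = 0]).
Proof.
split=> [[M [[_ _ _ M_hyper] M_type2]] j|long].
  (* Otherwise the empty family would span the kernel of [p j] in [M]. *)
  have [x [Mx pjx] x_neq0] : exists2 x, (M `&` [set x | p j x = 0]) x & x != 0.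
    apply: contrapT => M_trivial.
    apply: (M_type2 _ (hp j) (defining_seminorm_continuous hp hp_top j)).
    exists 0%N, (fun=> 0) => [[]//|x Mx]; exists (fun=> 0).
    rewrite big_ord0; apply: contrapT => /eqP x_neq0.
    by apply: M_trivial; exists x.
  apply: (long_null_intervals hX hfin hB x) => [|k].
    exact: M_hyper.
  exact: (seminorm_support he hp hp_mono).
have [a [a_sep a_null]] := separated_blocks _ long.
have [cls [s s_approx]] := recurrent_approximations K hK.
exists (class_multiples coef (coordinate_class (a := a) (cls := cls))
  (block_entries (w := w) (a := a) (s := s))).
exact: class_multiples_hypercyclic_subspace_type2.
Qed.
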